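(* Let $q\in(0,1)$, $n\ge1$. There exists a unique homomorphism of $*$-algebras $\psi:\mathrm{Pol}(\mathrm{Mat}_n)_q\to\mathrm{Pol}(S(\mathbb{U}))_q$ such that $\psi(z_a^\alpha)=z_a^\alpha$ for all $a,\alpha=1,\dots,n$.
   Context: All algebras are unital over $\mathbb{C}$. $\mathbb{C}[\mathrm{Mat}_n]_q$ is the algebra with generators $z_a^\alpha$, $a,\alpha=1,\dots,n$, and relations (R): $z_a^\alpha z_b^\beta-qz_b^\beta z_a^\alpha=0$ if ($a=b$ and $\alpha<\beta$) or ($a<b$ and $\alpha=\beta$); $z_a^\alpha z_b^\beta-z_b^\beta z_a^\alpha=0$ if $\alpha<\beta$ and $a>b$; $z_a^\alpha z_b^\beta-z_b^\beta z_a^\alpha=(q-q^{-1})z_a^\beta z_b^\alpha$ if $\alpha<\beta$ and $a<b$. $\mathrm{Pol}(\mathrm{Mat}_n)_q$ is the $*$-algebra with generators $z_a^\alpha,(z_a^\alpha)^*$, $a,\alpha=1,\dots,n$, subject to the relations (R) and $$(z_b^\beta)^*z_a^\alpha=q^2\sum_{a',b',\alpha',\beta'=1}^nR_{ba}^{b'a'}R_{\beta\alpha}^{\beta'\alpha'}z_{a'}^{\alpha'}(z_{b'}^{\beta'})^*+(1-q^2)\delta_{ab}\delta^{\alpha\beta},$$ where $R_{ij}^{kl}=q^{-1}$ if $i\ne j$, $i=k$, $j=l$; $R_{ij}^{kl}=1$ if $i=j=k=l$; $R_{ij}^{kl}=-(q^{-2}-1)$ if $i=j$, $k=l$, $l>j$;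 $R_{ij}^{kl}=0$ otherwise. Quantum minors: for $a_1<\dots<a_k$, $\alpha_1<\dots<\alpha_k$, $(z^{\wedge k})_{\{a_i\}}^{\{\alpha_i\}}=\sum_{s\in S_k}(-q)^{l(s)}z_{a_1}^{\alpha_{s(1)}}\cdots z_{a_k}^{\alpha_{s(k)}}$ ($l(s)$ = number of inversions); $\det_q\mathbf{z}=(z^{\wedge n})_{\{1..n\}}^{\{1..n\}}$ (central); $\det_q\mathbf{z}_a^\alpha=(z^{\wedge(n-1)})_{\{1..n\}\setminus\{a\}}^{\{1..n\}\setminus\{\alpha\}}$. $\mathbb{C}[GL_n]_q$ is the localization of $\mathbb{C}[\mathrm{Mat}_n]_q$ at the powers of $\det_q\mathbf{z}$. $\mathrm{Pol}(S(\mathbb{U}))_q$ denotes $\mathbb{C}[GL_n]_q$ equipped with the unique involution $*$ satisfying $(z_a^\alpha)^*=(-q)^{a+\alpha-2n}(\det_q\mathbf{z})^{-1}\det_q\mathbf{z}_a^\alpha$. *)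

(* Defs.v *)
From Stdlib Require Import Reals.
From HB Require Import structures.
From mathcomp Require Import all_boot all_order all_algebra all_fingroup.
From mathcomp Require Import complex.
From mathcomp Require Import Rstruct.

Set Implicit Arguments.
Unset Strict Implicit.
Unset Printing Implicit Defensive.

Import Order.TTheory GRing.Theory Num.Theory.
Local Open Scope ring_scope.

Notation CC := (complex R).

Section QuantumMatrices.

Variable q : CC.
Variable n : nat.

(* Indices a, alpha = 1..n of the paper are rendered as i : 'I_n, i.e. 0..n-1
   (the paper's a corresponds to the ordinal a-1; orderings are preserved). *)

Definition Rmat (i j k l : 'I_n) : CC :=
  if (i != j) && (i == k) && (j == l) then q^-1
  else if [&& i == j, j == k & k == l] then 1
  else if [&& i == j, k == l & (nat_of_ord j < nat_of_ord l)%N] then - (q ^- 2 - 1)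
  else 0.

Definition ninv (k : nat) (s : 'S_k) : nat :=
  #|[set p : 'I_k * 'I_k | (nat_of_ord p.1 < nat_of_ord p.2)%N && (nat_of_ord (s p.2) < nat_of_ord (s p.1))%N]|.

Variable A : algType CC.

(* z a alpha stands for z_a^alpha (lower index a, upper index alpha) *)
Variable z : 'I_n -> 'I_n -> A.

Definition relR : Prop :=
  forall a b al be : 'I_n,
    (((a == b) && (nat_of_ord al < nat_of_ord be)%N) || ((nat_of_ord a < nat_of_ord b)%N && (al == be)) ->
       z a al * z b be - q *: (z b be * z a al) = 0)
 /\ ((nat_of_ord al < nat_of_ord be)%N && (nat_of_ord b < nat_of_ord a)%N -> z a al * z b be - z b be * z a al = 0)
 /\ ((nat_of_ord al < nat_of_ord be)%N && (nat_of_ord a < nat_of_ord b)%N ->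
       z a al * z b be - z b be * z a al = (q - q^-1) *: (z a be * z b al)).

Definition relStar (st : A -> A) : Prop :=
  forall a b al be : 'I_n,
    st (z b be) * z a al =
      q ^+ 2 *: (\sum_(a' < n) \sum_(b' < n) \sum_(al' < n) \sum_(be' < n)
                   (Rmat b a b' a' * Rmat be al be' al') *: (z a' al' * st (z b' be')))
      + ((1 - q ^+ 2) * ((a == b)%:R * (al == be)%:R)) *: 1.

(* quantum minor with rows rows 0 < ... < rows (k-1) and columns
   cols 0 < ... < cols (k-1) (both strictly increasing in all uses below):
   sum_{s in S_k} (-q)^{l(s)} z_{rows 0}^{cols (s 0)} ... z_{rows (k-1)}^{cols (s (k-1))} *)
Definition qminor (k : nat) (rows cols : 'I_k -> 'I_n) : A :=
  \sum_(s : 'S_k) (- q) ^+ ninv s *: \prod_(i < k) z (rows i) (cols (s i)).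

Definition qdet : A := qminor id id.

(* det_q z_a^alpha : rows {1..n}\{a}, columns {1..n}\{alpha}, in increasing
   order (lift a enumerates the complement of a increasingly) *)
Definition qcof (a al : 'I_n) : A := @qminor n.-1 (lift a) (lift al).

End QuantumMatrices.

Definition is_involution (A : algType CC) (st : A -> A) : Prop :=
  [/\ forall x y : A, st (x + y) = st x + st y,
      forall (c : CC) (x : A), st (c *: x) = c^* *: st x,
      forall x y : A, st (x * y) = st y * st x
    & forall x : A, st (st x) = x].

Definition is_alg_hom (A B : algType CC) (f : A -> B) : Prop :=
  [/\ forall x y : A, f (x + y) = f x + f y,
      forall (c : CC) (x : A), f (c *: x) = c *: f x,
      forall x y : A, f (x * y) = f x * f y
    & f 1 = 1].

Definition is_star_hom (A B : algType CC) (stA : A -> A) (stB : B -> B)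
  (f : A -> B) : Prop :=
  is_alg_hom f /\ forall x : A, f (stA x) = stB (f x).

(* (P, stP, zP) is Pol(Mat_n)_q : the *-algebra generated by the z_a^alpha
   subject to (R) and the *-relations, characterised by its universal
   property among *-algebras over C. *)
Definition is_PolMat (q : CC) (n : nat) (P : algType CC) (stP : P -> P)
  (zP : 'I_n -> 'I_n -> P) : Prop :=
  [/\ is_involution stP, relR q zP, relStar q zP stP &
      forall (B : algType CC) (stB : B -> B) (w : 'I_n -> 'I_n -> B),
        is_involution stB -> relR q w -> relStar q w stB ->
        exists f : P -> B,
          [/\ is_star_hom stP stB f, (forall a al, f (zP a al) = w a al) &
              forall g : P -> B, is_star_hom stP stB g ->
                (forall a al, g (zP a al) = w a al) -> forall x, g x = f x]].

(* (G, zG) is C[GL_n]_q : the localisation of C[Mat_n]_q at the powers of the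
   (central) element det_q z, characterised by its universal property: the
   algebra generated by the z_a^alpha subject to (R) in which det_q z is
   invertible, universal among C-algebras with these properties. *)
Definition is_CGL (q : CC) (n : nat) (G : algType CC) (zG : 'I_n -> 'I_n -> G)
  : Prop :=
  [/\ relR q zG, (exists u : G, u * qdet q zG = 1 /\ qdet q zG * u = 1) &
      forall (B : algType CC) (w : 'I_n -> 'I_n -> B),
        relR q w -> (exists u : B, u * qdet q w = 1 /\ qdet q w * u = 1) ->
        exists f : G -> B,
          [/\ is_alg_hom f, (forall a al, f (zG a al) = w a al) &
              forall g : G -> B, is_alg_hom g ->
                (forall a al, g (zG a al) = w a al) -> forall x, g x = f x]].

(* (G, stG) is Pol(S(U))_q : C[GL_n]_q with the involution determined by
   (z_a^alpha)^* = (-q)^{a+alpha-2n} (det_q z)^{-1} det_q z_a^alpha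
   (here with 0-based indices, a+alpha-2n becomes (a+1)+(alpha+1)-2n). *)
Definition is_PolSU (q : CC) (n : nat) (G : algType CC) (stG : G -> G)
  (zG : 'I_n -> 'I_n -> G) : Prop :=
  [/\ is_CGL q zG, is_involution stG &
      exists u : G, [/\ u * qdet q zG = 1, qdet q zG * u = 1 &
        forall a al : 'I_n,
          stG (zG a al) =
            (- q) ^ ((a.+1 + al.+1)%:Z - (2 * n)%:Z) *: (u * qcof q zG a al)]].

(* Main.v *)
Require Import Defs.
From Stdlib Require Import Reals.
From HB Require Import structures.
From mathcomp Require Import all_boot all_order all_algebra all_fingroup.
From mathcomp Require Import complex.
From mathcomp Require Import Rstruct.
From mathcomp Require Import zify ring.
Import Order.TTheory GRing.Theory Num.Theory.
Local Open Scope ring_scope.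

Set Implicit Arguments.
Unset Strict Implicit.
Unset Printing Implicit Defensive.

(* By the universal property of Pol(Mat_n)_q, it suffices that the elements
   (z_b^beta)^* of Pol(S(U))_q satisfy the star relations.  Quantum minors are
   q-alternating in their rows and invariant under transposition; this gives
   Laplace expansions with the generator on either side, so that the matrix
   Y_{beta b} = (-q)^{beta-b} det_q^{-1} det_q z_b^beta is a two-sided inverse of
   the generating matrix Z (and det_q is central).  Writing (R) as
   R Z_1 Z_2 = Z_2 Z_1 R and multiplying by Y_2 on both sides gives
   Y_2 R Z_1 = Z_1 R Y_2.  Since (z_b^beta)^* = q^{2(b-n)} Y_{beta b}, these are
   the star relations up to a triangular system for the terms with a = b; solving
   it by means of Y Z = 1 produces the constant term (1 - q^2). *)

(** * Inversions and adjacent transpositions *)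

(** Extends [ninv] to index sequences with possible repetitions; it is the measure for sorting the
    rows of a minor. *)
Definition invs (k n : nat) (r : 'I_k -> 'I_n) : nat :=
  #|[set p : 'I_k * 'I_k | (p.1 < p.2)%N && (r p.2 < r p.1)%N]|.

(** Applying [tperm i j] to both entries of a pair matches the inversions of the swapped sequence
    other than [(i, j)] with those of [r], because adjacency preserves the order of every other
    pair. *)
Lemma invs_adj_swap (k n : nat) (r : 'I_k -> 'I_n) (i j : 'I_k) :
  j = i.+1 :> nat -> (r i < r j)%N -> invs (r \o tperm i j) = (invs r).+1.
Proof.
move=> ij rij; rewrite /invs (cardsD1 (i, j)) inE /= tpermL tpermR rij andbT.
rewrite {1}ij ltnSn add1n; congr _.+1.
pose g (p : 'I_k * 'I_k) := (tperm i j p.1, tperm i j p.2).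
have gK : involutive g by case=> x y; rewrite /g /= !tpermK.
rewrite -[RHS](card_imset _ (inv_inj gK)); congr #|pred_of_set _|; apply/setP=> p.
rewrite -{2}[p]gK mem_imset; last exact: inv_inj.
rewrite !inE /g; case: p => x y /=; rewrite xpair_eqE.
have E (u v : 'I_k) : (u == v) = (u == v :> nat) by [].
case: (tpermP i j x) => [->|->|/eqP + /eqP]; case: (tpermP i j y) => [->|->|/eqP + /eqP];
  rewrite ?E; lia.
Qed.

(** [L] and [R] are chosen before [h], so products that differ only at positions [i] and [j] share
    their outer factors. *)
Lemma prod_adj_split (A : nzRingType) (k : nat) (i j : 'I_k) (f : 'I_k -> A) :
  j = i.+1 :> nat ->
  exists L R : A, forall h : 'I_k -> A,
    (forall x, x != i -> x != j -> h x = f x) ->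
    \prod_(x < k) h x = L * (h i * h j) * R.
Proof.
(* Extending by 1 to all naturals allows cutting the product into intervals. *)
move=> ij; pose ext (h : 'I_k -> A) m := if insub m is Some x then h x else 1.
have extE h : \prod_(x < k) h x = \prod_(0 <= m < k) ext h m.
  by rewrite big_mkord; apply: eq_bigr => x _; rewrite /ext valK.
have exto h (x : 'I_k) : ext h x = h x by rewrite /ext valK.
exists (\prod_(0 <= m < i) ext f m), (\prod_(j.+1 <= m < k) ext f m) => h hf.
have lik := ltn_ord i; have ljk := ltn_ord j.
rewrite extE (big_cat_nat (n := i)) //=; last exact: ltnW.
rewrite [X in _ * X]big_ltn // -ij [X in _ * (_ * X)]big_ltn // !exto !mulrA.
have hext (m : nat) : m != i :> nat -> m != j :> nat -> ext h m = ext f m.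
  by rewrite /ext; case: insubP => // u _ <- *; apply: hf.
by congr (_ * _ * _ * _); apply: eq_big_nat => m /andP[m1 m2]; apply: hext; lia.
Qed.

Lemma sum_perm_adj (V : zmodType) (k : nat) (i j : 'I_k) (X : 'S_k -> V) :
  i != j ->
  \sum_s X s = \sum_(s : 'S_k | (s i < s j)%N) (X s + X (tperm i j * s)%g).
Proof.
move=> ij; rewrite (bigID (fun s : 'S_k => (s i < s j)%N)) /= big_split /=; congr (_ + _).
rewrite (reindex_inj (mulgI (tperm i j))) /=; apply: eq_bigl => s.
rewrite !permM tpermL tpermR -leqNgt leq_eqVlt.
by rewrite (inj_eq val_inj) (inj_eq perm_inj) (negbTE ij).
Qed.

Lemma ninv_adj (k : nat) (s : 'S_k) (i j : 'I_k) :
  j = i.+1 :> nat -> (s i < s j)%N -> ninv (tperm i j * s)%g = (ninv s).+1.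
Proof.
move=> ij sij; rewrite -[RHS](invs_adj_swap ij sij) /ninv /invs.
by apply: eq_card => p; rewrite !inE /= !permM.
Qed.

Lemma adj_le_mono (k n : nat) (r : 'I_k -> 'I_n) :
  (forall i j : 'I_k, j = i.+1 :> nat -> (r i <= r j)%N) ->
  forall x y : 'I_k, (x <= y)%N -> (r x <= r y)%N.
Proof.
move=> H x y; move: {2}(y - x)%N (erefl (y - x)%N) => d.
elim: d y => [|d IH] y yx xy.
  by have -> : x = y by apply: val_inj => /=; lia.
have lty := ltn_ord y; have lt' : (y.-1 < k)%N by lia.
apply: (leq_trans (IH (Ordinal lt') _ _)) => /=; [lia|lia|].
by apply: H => /=; lia.
Qed.

(** Drives sorting: either some adjacent swap removes an inversion, or the sequence is already
    sorted. *)
Lemma adj_descent (k n : nat) (r : 'I_k -> 'I_n) :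
  (exists i j : 'I_k, j = i.+1 :> nat /\ (r j < r i)%N) \/
  (forall x y : 'I_k, (x <= y)%N -> (r x <= r y)%N).
Proof.
case: (boolP [exists i : 'I_k, exists j : 'I_k, (nat_of_ord j == i.+1) && (r j < r i)%N]).
  by move=> /existsP[i /existsP[j /andP[/eqP ij rij]]]; left; exists i, j.
move=> H; right; apply: adj_le_mono => i j ij; rewrite leqNgt; apply: contra H => rij.
by apply/existsP; exists i; apply/existsP; exists j; rewrite ij eqxx.
Qed.

Lemma tperm_compK (T : Type) (k : nat) (i j : 'I_k) (r : 'I_k -> T) :
  (r \o tperm i j) \o tperm i j =1 r.
Proof. by move=> x /=; rewrite tpermK. Qed.

(** Monotonicity and injectivity give [x <= s x]; the same bound for the inverse gives equality. *)
Lemma perm_mono_id (k : nat) (s : 'S_k) :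
  (forall x y : 'I_k, (x <= y)%N -> (s x <= s y)%N) -> s = 1%g.
Proof.
have ge (t : 'S_k) : (forall x y : 'I_k, (x <= y)%N -> (t x <= t y)%N) ->
    forall x : 'I_k, (x <= t x)%N.
  move=> mono [m]; elim: m => [|m IH] lt //=.
  have lt' := ltnW lt; apply: (leq_ltn_trans (IH lt')).
  by rewrite ltn_neqAle mono //= (inj_eq val_inj) (inj_eq perm_inj) -(inj_eq val_inj) /=; lia.
move=> mono; have mono' (x y : 'I_k) : (x <= y)%N -> ((s^-1)%g x <= (s^-1)%g y)%N.
  move=> xy; rewrite leqNgt; apply/negP => lt.
  have := mono _ _ (ltnW lt); rewrite !permKV => yx.
  by move: lt; rewrite (_ : x = y) ?ltnn //; apply: val_inj => /=; lia.
apply/permP => x; rewrite perm1; apply: val_inj => /=; apply/eqP.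
by rewrite eqn_leq (ge _ mono) andbT -{2}[x](permK s) (ge _ mono').
Qed.

Lemma sum_delta (V : nmodType) (n : nat) (F : 'I_n -> V) (b : 'I_n) :
  \sum_c F c *+ (c == b) = F b.
Proof.
rewrite (bigD1 b) //= eqxx big1 ?addr0 // => c /negbTE ->.
by rewrite mulr0n.
Qed.

Lemma ninv1 (k : nat) : ninv (1%g : 'S_k) = 0%N.
Proof. by apply: eq_card0 => p; rewrite !inE !perm1; lia. Qed.

(** * Quantum minors are q-alternating in their rows *)

(** The terms of [s] and [tperm i j * s] combine into a 2x2 quantum minor in the rows [r' i] and
    [r' j]. The factors [L] and [R] do not depend on these two rows, so they serve a row sequence
    and its swap alike. *)
Lemma qminor_adj_sum (q : CC) (n k : nat) (A : algType CC) (z : 'I_n -> 'I_n -> A)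
    (c r : 'I_k -> 'I_n) (i j : 'I_k) (s : 'S_k) :
  j = i.+1 :> nat -> (s i < s j)%N ->
  exists L R : A, forall r' : 'I_k -> 'I_n,
    (forall x, x != i -> x != j -> r' x = r x) ->
    (- q) ^+ ninv s *: \prod_(x < k) z (r' x) (c (s x)) +
    (- q) ^+ ninv (tperm i j * s)%g *:
       \prod_(x < k) z (r' x) (c ((tperm i j * s)%g x)) =
    (- q) ^+ ninv s *:
      (L * (z (r' i) (c (s i)) * z (r' j) (c (s j))
            - q *: (z (r' i) (c (s j)) * z (r' j) (c (s i)))) * R).
Proof.
move=> ij sij.
have [L [R H]] := @prod_adj_split A k i j (fun x => z (r x) (c (s x))) ij.
exists L, R => r' Hr; rewrite H; last by move=> x xi xj; rewrite Hr.
rewrite H; last by move=> x xi xj; rewrite Hr // permM tpermD // eq_sym.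
rewrite (ninv_adj ij sij) exprSr -scalerA -scalerDr !permM tpermL tpermR.
by rewrite scaleNr mulrBr mulrBl -scalerAr -scalerAl.
Qed.

Section Alternating.

Context (q : CC) (n : nat) (A : algType CC) (z : 'I_n -> 'I_n -> A).
Hypothesis qn0 : q != 0.
Hypothesis zR : relR q z.

Lemma relR_row (a al be : 'I_n) : (al < be)%N -> z a al * z a be = q *: (z a be * z a al).
Proof.
by move=> h; have [+ _] := zR a a al be; rewrite eqxx h => /(_ isT)/eqP;
  rewrite subr_eq0 => /eqP.
Qed.

Lemma relR_col (a b al : 'I_n) : (a < b)%N -> z a al * z b al = q *: (z b al * z a al).
Proof.
by move=> h; have [+ _] := zR a b al al; rewrite eqxx h orbT => /(_ isT)/eqP;
  rewrite subr_eq0 => /eqP.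
Qed.

Lemma relR_comm (a b al be : 'I_n) : (al < be)%N -> (b < a)%N ->
  z a al * z b be = z b be * z a al.
Proof.
by move=> h h'; have [_ [+ _]] := zR a b al be; rewrite h h' => /(_ isT)/eqP;
  rewrite subr_eq0 => /eqP.
Qed.

Lemma relR_cross (a b al be : 'I_n) : (al < be)%N -> (a < b)%N ->
  z a al * z b be = z b be * z a al + (q - q^-1) *: (z a be * z b al).
Proof.
by move=> h h'; have [_ [_ +]] := zR a b al be; rewrite h h' => /(_ isT)/eqP;
  rewrite subr_eq addrC => /eqP.
Qed.

Lemma eq_qminor (k : nat) (r r' c : 'I_k -> 'I_n) : r =1 r' ->
  qminor q z r c = qminor q z r' c.
Proof.
move=> rr; apply: eq_bigr => s _; congr (_ *: _).
by apply: eq_bigr => x _; rewrite rr.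
Qed.

Context (k : nat) (c : 'I_k -> 'I_n).
Hypothesis c_incr : forall x y : 'I_k, (x < y)%N -> (c x < c y)%N.

(** Every 2x2 minor with two equal rows vanishes by the row relation. *)
Lemma qminor_adj_eq (r : 'I_k -> 'I_n) (i j : 'I_k) :
  j = i.+1 :> nat -> r i = r j -> qminor q z r c = 0.
Proof.
move=> ij rij; rewrite /qminor (@sum_perm_adj _ _ i j);
  last by rewrite -(inj_eq val_inj) /=; lia.
apply: big1 => s sij; have [L [R ->//]] := @qminor_adj_sum q n k A z c r i j s ij sij.
by rewrite rij relR_row ?subrr ?mulr0 ?mul0r ?scaler0 // c_incr.
Qed.

(** By the commuting and cross relations, exchanging the rows of a 2x2 minor multiplies it by
    [- q]. *)
Lemma qminor_adj_swap (r : 'I_k -> 'I_n) (i j : 'I_k) :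
  j = i.+1 :> nat -> (r i < r j)%N ->
  qminor q z (r \o tperm i j) c = (- q) *: qminor q z r c.
Proof.
move=> ij rij; have nij : i != j by rewrite -(inj_eq val_inj) /=; lia.
rewrite /qminor !(@sum_perm_adj _ _ i j) // scaler_sumr.
apply: eq_bigr => s sij; have [L [R H]] := @qminor_adj_sum q n k A z c r i j s ij sij.
rewrite !H //; last by move=> x xi xj /=; rewrite tpermD // eq_sym.
rewrite scalerA mulrC -scalerA /= tpermL tpermR; congr (_ *: _).
rewrite [RHS]scalerAl [X in _ = X * _]scalerAr; congr (_ * _ * _).
have cs := c_incr sij.
rewrite (relR_comm cs rij) (relR_cross cs rij) -addrA -scalerBl.
have -> : q - q^-1 - q = - q^-1 by ring.
by rewrite scalerDr !scalerA mulrNN mulfV // scale1r scaleNr addrC.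
Qed.

(** Induction on inversions: a swap at a descent only rescales the minor, and in sorted rows a
    repetition forces two adjacent equal rows. *)
Lemma qminor_noninj (r : 'I_k -> 'I_n) (x y : 'I_k) :
  (x < y)%N -> r x = r y -> qminor q z r c = 0.
Proof.
move: {2}(invs r) (erefl (invs r)) => d; elim: d r x y => [|d IH] r x y.
all: have [[i [j [ij rij]]]|mono] := adj_descent r; last first.
1,3: move=> _ xy rxy; have lty := ltn_ord y; have lt' : (x.+1 < k)%N by lia.
1,2: apply: (@qminor_adj_eq r x (Ordinal lt')) => //; apply/val_inj/eqP; rewrite eqn_leq.
1,2: by rewrite mono ?rxy ?mono /=; lia.
all: have := invs_adj_swap (r := r \o tperm i j) ij; rewrite /= tpermL tpermR => /(_ rij).
all: have -> : invs ((r \o tperm i j) \o tperm i j) = invs r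
  by apply: eq_card => p; rewrite !inE /= !tpermK.
all: move=> -> // [rd] xy rxy.
rewrite -(eq_qminor c (tperm_compK i j r)) qminor_adj_swap //= ?tpermL ?tpermR //.
have nxy : tperm i j x != tperm i j y by rewrite (inj_eq perm_inj) -(inj_eq val_inj) /=; lia.
have [lt|lt|/val_inj/eqP] := ltngtP (tperm i j x) (tperm i j y); last by rewrite (negbTE nxy).
  by rewrite (IH _ _ _ rd lt) ?scaler0 //= !tpermK.
by rewrite (IH _ _ _ rd lt) ?scaler0 //= !tpermK.
Qed.

(** Sorting [s] takes [ninv s] adjacent swaps, each contributing [- q]. *)
Lemma qminor_perm (r : 'I_k -> 'I_n) (s : 'S_k) :
  (forall x y : 'I_k, (x < y)%N -> (r x < r y)%N) ->
  qminor q z (r \o s) c = (- q) ^+ ninv s *: qminor q z r c.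
Proof.
move=> r_incr; move: {2}(ninv s) (erefl (ninv s)) => d; elim: d s => [|d IH] s.
all: have [[i [j [ij sij]]]|mono] := adj_descent s; last first.
1,3: rewrite (perm_mono_id mono) => _.
1,2: by rewrite ninv1 scale1r; apply: eq_qminor => x /=; rewrite perm1.
all: have := @ninv_adj _ (tperm i j * s)%g i j ij; rewrite !permM tpermL tpermR => /(_ sij).
all: rewrite mulgA tperm2 mul1g => -> // [sd].
have e : ((r \o (tperm i j * s)%g) \o tperm i j) =1 r \o s
  by move=> x; rewrite /= permM tpermK.
rewrite -(eq_qminor c e) qminor_adj_swap //= ?permM ?tpermL ?tpermR ?r_incr // IH //.
by rewrite scalerA exprS.
Qed.

End Alternating.

(** * Laplace expansions *)

Lemma ninv_sum (k : nat) (s : 'S_k) :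
  ninv s = (\sum_(x < k) \sum_(y < k) ((x < y) && (s y < s x))%N)%N.
Proof.
by rewrite /ninv -sum1_card pair_big big_mkcond; apply: eq_bigr => p _; rewrite inE; case: ifP.
Qed.

Lemma sum_ord_lt (m a : nat) : (\sum_(x < m) (x < a)%N = minn m a)%N.
Proof. elim: m => [|m IH]; rewrite ?big_ord0 ?big_ord_recr /= ?IH; lia. Qed.

Lemma widen_ord_lift (m : nat) (x : 'I_m) : widen_ord (leqnSn m) x = lift ord_max x.
Proof. by apply: val_inj; rewrite /= /bump leqNgt ltn_ord. Qed.

Lemma lift_ltn (m : nat) (a : 'I_m.+1) (x y : 'I_m) : (lift a x < lift a y)%N = (x < y)%N.
Proof. by rewrite /= /bump; lia. Qed.

(** The first position carries the value [a], so it is inverted with the [a] smaller values; [lift]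
    is increasing, so the rest contributes [ninv s]. *)
Lemma ninv_lift_ord0 (m : nat) (a : 'I_m.+1) (s : 'S_m) :
  ninv (lift_perm ord0 a s) = (a + ninv s)%N.
Proof.
rewrite !ninv_sum big_ord_recl; congr (_ + _)%N.
  rewrite big_ord_recl /= add0n.
  transitivity (\sum_(x < m) (x < a)%N)%N; last by rewrite sum_ord_lt; have := ltn_ord a; lia.
  rewrite [RHS](reindex_inj (@perm_inj _ s)) /=; apply: eq_bigr => x _.
  by rewrite lift_perm_id lift_perm_lift /= /bump; lia.
apply: eq_bigr => x _; rewrite big_ord_recl /= add0n; apply: eq_bigr => y _.
by rewrite !lift_perm_lift lift_ltn.
Qed.

Lemma ninv_lift_ord_max (m : nat) (a : 'I_m.+1) (s : 'S_m) :
  ninv (lift_perm ord_max a s) = (m - a + ninv s)%N.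
Proof.
rewrite !ninv_sum big_ord_recr /= [X in (_ + X)%N = _]big1; last first.
  by move=> y _; rewrite ltnNge -ltnS ltn_ord.
rewrite addn0.
transitivity (\sum_(x < m) ((a <= s x) + \sum_(y < m) ((x < y) && (s y < s x))%N))%N.
  apply: eq_bigr => x _; rewrite big_ord_recr [LHS]addnC /=; congr (_ + _)%N.
    rewrite widen_ord_lift lift_perm_id lift_perm_lift /= /bump; have := ltn_ord x; lia.
  by apply: eq_bigr => y _; rewrite !widen_ord_lift !lift_perm_lift lift_ltn.
rewrite big_split /=; congr (_ + _)%N.
transitivity (\sum_(x < m) (a <= x))%N; first by rewrite [RHS](reindex_inj (@perm_inj _ s)).
have := sum_ord_lt m a; have := ltn_ord a.
have : (\sum_(x < m) (a <= x) + \sum_(x < m) (x < a) = m)%N.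
  rewrite -big_split /= -[RHS]card_ord -sum1_card; apply: eq_bigr => x _; lia.
lia.
Qed.

(** Permutations are grouped by their value at [i0]; injectivity suffices, by counting. *)
Lemma sum_lift_perm (V : nmodType) (m : nat) (i0 : 'I_m.+1) (F : 'S_m.+1 -> V) :
  \sum_s F s = \sum_(a < m.+1) \sum_(s : 'S_m) F (lift_perm i0 a s).
Proof.
rewrite pair_big /= (reindex (fun p : 'I_m.+1 * 'S_m => lift_perm i0 p.1 p.2)) //=.
apply/onW_bij/inj_card_bij; last by rewrite card_prod card_ord !card_Sn factS.
case=> [a s] [b t] /= /permP e.
have ab : a = b by have := e i0; rewrite !lift_perm_id.
move: e; rewrite -ab => e; congr pair; apply/permP => x.
by apply: (@lift_inj _ a); have := e (lift i0 x); rewrite !lift_perm_lift.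
Qed.

Definition transposed (n : nat) (T : Type) (z : 'I_n -> 'I_n -> T) := fun a al => z al a.

Section Laplace.

Context (q : CC) (m : nat) (A : algType CC) (z : 'I_m.+1 -> 'I_m.+1 -> A).

(** The rows are arbitrary so that the expansion also applies when one is repeated. *)
Lemma qminor_expand_first (r : 'I_m.+1 -> 'I_m.+1) :
  qminor q z r id = \sum_(al < m.+1)
    (- q) ^+ al *: (z (r ord0) al * qminor q z (r \o lift ord0) (lift al)).
Proof.
rewrite /qminor (sum_lift_perm ord0); apply: eq_bigr => al _.
rewrite mulr_sumr scaler_sumr; apply: eq_bigr => s _.
rewrite ninv_lift_ord0 exprD -scalerA -scalerAr big_ord_recl lift_perm_id;
  congr (_ *: (_ *: (_ * _))).
by apply: eq_bigr => x _; rewrite lift_perm_lift.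
Qed.

Lemma qminor_expand_last (r : 'I_m.+1 -> 'I_m.+1) :
  qminor q z r id = \sum_(al < m.+1)
    (- q) ^+ (m - al) *: (qminor q z (r \o lift ord_max) (lift al) * z (r ord_max) al).
Proof.
rewrite /qminor (sum_lift_perm ord_max); apply: eq_bigr => al _.
rewrite mulr_suml scaler_sumr; apply: eq_bigr => s _.
rewrite ninv_lift_ord_max exprD -scalerA -scalerAl big_ord_recr lift_perm_id;
  congr (_ *: (_ *: (_ * _))).
by apply: eq_bigr => x _; rewrite widen_ord_lift lift_perm_lift.
Qed.

Hypothesis qn0 : q != 0.
Hypothesis zR : relR q z.

(* The rows of [qdet] with row [b] deleted and row [a] inserted at position [i0]. *)
Lemma qminor_bordered (i0 a b : 'I_m.+1) :
  qminor q z (fun x => if unlift i0 x is Some y then lift b y else a) id =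
  ((- q) ^+ ninv (lift_perm i0 a (1%g : 'S_m)) * (a == b)%:R) *: qdet q z.
Proof.
(* For [a = b] the rows form the permutation [lift_perm i0 a 1]. *)
set r := fun x => _; have [ab|ab] := eqVneq a b.
  rewrite mulr1 -(@qminor_perm q _ A z qn0 zR _ id) //; apply: eq_qminor => x.
  by rewrite /r -ab /=; case: (unliftP i0 x) => [y|] ->;
    rewrite ?lift_perm_id ?lift_perm_lift ?perm1 ?liftK // unlift_none.
rewrite mulr0 scale0r.
(* For [a != b] the row [a] occurs twice, at [i0] and at [lift i0 c]. *)
have [c ac] : exists c, a = lift b c by move: ab; rewrite eq_sym => /unlift_some[c]; exists c.
have rE : r i0 = r (lift i0 c) by rewrite /r unlift_none liftK.
have ne := neq_lift i0 c; rewrite -(inj_eq val_inj) in ne.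
have [lt|lt|/eqP e] := ltngtP i0 (lift i0 c); last by rewrite e in ne.
  exact: (@qminor_noninj q _ A z qn0 zR _ _ _ _ _ _ lt).
by apply: (@qminor_noninj q _ A z qn0 zR _ _ _ _ _ _ lt).
Qed.

Lemma laplace_first (a b : 'I_m.+1) :
  \sum_(al < m.+1) (- q) ^+ al *: (z a al * qcof q z b al) =
  ((- q) ^+ a * (a == b)%:R) *: qdet q z.
Proof.
have := qminor_bordered ord0 a b.
rewrite ninv_lift_ord0 ninv1 addn0 => <-.
rewrite qminor_expand_first; apply: eq_bigr => al _; rewrite unlift_none; congr (_ *: (_ * _)).
by apply: eq_qminor => x /=; rewrite liftK.
Qed.

Lemma laplace_last (a b : 'I_m.+1) :
  \sum_(al < m.+1) (- q) ^+ (m - al) *: (qcof q z b al * z a al) =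
  ((- q) ^+ (m - a) * (a == b)%:R) *: qdet q z.
Proof.
have := qminor_bordered ord_max a b.
rewrite ninv_lift_ord_max ninv1 addn0 => <-.
rewrite qminor_expand_last; apply: eq_bigr => al _; rewrite unlift_none; congr (_ *: (_ * _)).
by apply: eq_qminor => x /=; rewrite liftK.
Qed.

End Laplace.

(** * Invariance under transposition *)

(** Row and column relations trade places; the cross relation is preserved because the two factors
    on its right commute. *)
Lemma relR_transposed (q : CC) (n : nat) (A : algType CC) (z : 'I_n -> 'I_n -> A) :
  relR q z -> relR q (transposed z).
Proof.
move=> zR a b al be; rewrite /transposed; split; [|split].
- case/orP => /andP[].
    by move/eqP <- => lt; rewrite (relR_col zR) // subrr.
  by move=> lt /eqP <-; rewrite (relR_row zR) // subrr.
- by move=> /andP[lt lt']; rewrite (relR_comm zR lt' lt) subrr.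
- move=> /andP[lt lt']; rewrite (relR_cross zR lt' lt) addrC addKr.
  by rewrite (relR_comm zR lt' lt).
Qed.

(* Both sides, multiplied by the sum of q^(2 l(s)) over s in S_k, equal the double sum
   over s and t of (-q)^(l(s) + l(t)) times the product of the z (r (t x)) (c (s x)). *)
Lemma qminor_transposed (q : CC) (n k : nat) (A : algType CC) (z : 'I_n -> 'I_n -> A)
    (r c : 'I_k -> 'I_n) :
  0 < q -> relR q z ->
  (forall x y : 'I_k, (x < y)%N -> (r x < r y)%N) ->
  (forall x y : 'I_k, (x < y)%N -> (c x < c y)%N) ->
  qminor q (transposed z) c r = qminor q z r c.
Proof.
move=> q0 zR r_incr c_incr; have qn0 : q != 0 by rewrite gt_eqF.
pose N := \sum_(s : 'S_k) (- q) ^+ ninv s * (- q) ^+ ninv s.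
(* The identity contributes 1 and, as [q] is positive, all other terms are nonnegative. *)
have Nn0 : N != 0.
  rewrite gt_eqF // /N (bigD1 (1%g : 'S_k)) //= ninv1 expr0 mulr1.
  apply: ltr_wpDr => //; apply: sumr_ge0 => s _.
  by rewrite -exprMn mulrNN exprn_ge0 // mulr_ge0 // ltW.
apply: (scalerI Nn0); rewrite /N !scaler_suml.
transitivity (\sum_(s : 'S_k) \sum_(t : 'S_k)
   ((- q) ^+ ninv s * (- q) ^+ ninv t) *: \prod_(x < k) z (r (t x)) (c (s x))).
  apply: eq_bigr => s _; rewrite -scalerA -(qminor_perm qn0 (relR_transposed zR)) //.
  by rewrite scaler_sumr; apply: eq_bigr => t _; rewrite scalerA.
rewrite exchange_big /=; apply: eq_bigr => t _; rewrite -scalerA -(qminor_perm qn0 zR) //.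
by rewrite scaler_sumr; apply: eq_bigr => s _; rewrite scalerA mulrC.
Qed.

(** * Exchange relations for the inverse matrix, and the triangular system *)

Section InverseMatrix.

Context (q : CC) (n : nat) (A : algType CC) (z y : 'I_n -> 'I_n -> A).
Hypothesis qn0 : q != 0.
Hypothesis zR : relR q z.

(* Entrywise form of R Z_1 Z_2 = Z_2 Z_1 R. *)
Lemma relR_RTT (a c al ga : 'I_n) :
  q ^+ (a == c) *: (z a al * z c ga) + ((q - q^-1) * (c < a)%N%:R) *: (z c al * z a ga) =
  q ^+ (al == ga) *: (z c ga * z a al) + ((q - q^-1) * (al < ga)%N%:R) *: (z c al * z a ga).
Proof.
have [ac|ca|/val_inj e] := ltngtP a c.
- rewrite mulr0 scale0r addr0 (_ : (a == c) = false) ?scale1r;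
    last by apply/eqP => e; rewrite e ltnn in ac.
  have [lt|lt|/val_inj <-] := ltngtP al ga.
  + rewrite (relR_cross zR) // (relR_comm zR lt ac) mulr1 (_ : (al == ga) = false) ?scale1r //.
    by apply/eqP => e; rewrite e ltnn in lt.
  + rewrite -(relR_comm zR lt ac) mulr0 scale0r addr0 (_ : (al == ga) = false) ?scale1r //.
    by apply/eqP => e; rewrite e ltnn in lt.
  + by rewrite (relR_col zR) // eqxx mulr0 scale0r addr0.
- rewrite mulr1 (_ : (a == c) = false) ?scale1r; last by apply/eqP => e; rewrite e ltnn in ca.
  have [lt|lt|/val_inj <-] := ltngtP al ga.
  + rewrite (relR_comm zR lt ca) mulr1 (_ : (al == ga) = false) ?scale1r //.
    by apply/eqP => e; rewrite e ltnn in lt.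
  + rewrite (relR_cross zR lt ca) mulr0 scale0r addr0 (_ : (al == ga) = false) ?scale1r //.
    by apply/eqP => e; rewrite e ltnn in lt.
  + rewrite (relR_col zR _ ca) // eqxx mulr0 scale0r addr0 scalerBl.
    by rewrite !scalerA mulVf // scale1r addrC subrK.
- rewrite -e mulr0 scale0r addr0 eqxx.
  have [lt|lt|/val_inj <-] := ltngtP al ga.
  + rewrite (relR_row zR) // (_ : (al == ga) = false);
      last by apply/eqP => e'; rewrite e' ltnn in lt.
    by rewrite mulr1 scalerBl !scalerA mulVf // !scale1r addrC subrK.
  + rewrite -(relR_row zR) // mulr0 scale0r addr0 (_ : (al == ga) = false) ?scale1r //.
    by apply/eqP => e'; rewrite e' ltnn in lt.
  + by rewrite eqxx mulr0 scale0r addr0.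
Qed.

Hypothesis yz : forall be al, \sum_c y be c * z c al = (be == al)%:R.
Hypothesis zy : forall a b, \sum_ga z a ga * y ga b = (a == b)%:R.

(* Entrywise form of Y_2 R Z_1 = Z_1 R Y_2. *)
Lemma inverse_RTT (a b al be : 'I_n) :
  q ^+ (a == b) *: (y be b * z a al)
    + ((q - q^-1) * (a == b)%:R) *: \sum_(c < n | (c < a)%N) y be c * z c al =
  q ^+ (al == be) *: (z a al * y be b)
    + ((q - q^-1) * (al == be)%:R) *: \sum_(ga < n | (al < ga)%N) z a ga * y ga b.
Proof.
(* The RTT relation is multiplied by [y be c] and [y ga b] and summed; [zy] then contracts [ga] on
   the left side and [yz] contracts [c] on the right side. *)
have : \sum_c \sum_ga y be c * (q ^+ (a == c) *: (z a al * z c ga)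
         + ((q - q^-1) * (c < a)%N%:R) *: (z c al * z a ga)) * y ga b =
       \sum_c \sum_ga y be c * (q ^+ (al == ga) *: (z c ga * z a al)
         + ((q - q^-1) * (al < ga)%N%:R) *: (z c al * z a ga)) * y ga b.
  by apply: eq_bigr => c _; apply: eq_bigr => ga _; rewrite relR_RTT.
rewrite [X in _ = X]exchange_big /=.
under eq_bigr => c _ do under eq_bigr => ga _ do rewrite mulrDr mulrDl.
under eq_bigr => c _ do rewrite big_split /=.
under [in X in _ = X]eq_bigr => ga _ do under eq_bigr => c _ do rewrite mulrDr mulrDl.
under [in X in _ = X]eq_bigr => ga _ do rewrite big_split /=.
rewrite !big_split /= => H.
have <- : \sum_c \sum_ga y be c * (q ^+ (a == c) *: (z a al * z c ga)) * y ga b =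
          q ^+ (a == b) *: (y be b * z a al).
  rewrite -[RHS](sum_delta (fun c => q ^+ (a == c) *: (y be c * z a al))).
  apply: eq_bigr => c _; rewrite -mulr_natr -zy mulr_sumr; apply: eq_bigr => ga _.
  by rewrite -!(scalerAl, scalerAr) !mulrA.
have <- : \sum_c \sum_ga y be c * (((q - q^-1) * (c < a)%N%:R) *: (z c al * z a ga)) * y ga b =
          ((q - q^-1) * (a == b)%:R) *: \sum_(c < n | (c < a)%N) y be c * z c al.
  rewrite [in RHS]big_mkcond scaler_sumr; apply: eq_bigr => c _.
  transitivity (((q - q^-1) * (c < a)%N%:R) *: (y be c * z c al * \sum_ga z a ga * y ga b)).
    rewrite mulr_sumr scaler_sumr; apply: eq_bigr => ga _.
    by rewrite -!(scalerAl, scalerAr) !mulrA.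
  rewrite zy; case: (c < a)%N; case: (a == b); rewrite ?mulr0 ?mulr1 ?scale0r ?scaler0 //.
have <- : \sum_(ga < n) \sum_(c < n) y be c * (q ^+ (al == ga) *: (z c ga * z a al)) * y ga b =
          q ^+ (al == be) *: (z a al * y be b).
  rewrite -[RHS](sum_delta (fun ga => q ^+ (al == ga) *: (z a al * y ga b))).
  apply: eq_bigr => ga _; rewrite -mulr_natl [ga == be]eq_sym -yz mulr_suml;
    apply: eq_bigr => c _.
  by rewrite -!(scalerAl, scalerAr) !mulrA.
have <- : \sum_(ga < n) \sum_(c < n)
            y be c * (((q - q^-1) * (al < ga)%N%:R) *: (z c al * z a ga)) * y ga b =
          ((q - q^-1) * (al == be)%:R) *: \sum_(ga < n | (al < ga)%N) z a ga * y ga b.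
  rewrite [in RHS]big_mkcond scaler_sumr; apply: eq_bigr => ga _.
  transitivity (((q - q^-1) * (al < ga)%N%:R) *:
    ((\sum_c y be c * z c al) * (z a ga * y ga b))).
    rewrite mulr_suml scaler_sumr; apply: eq_bigr => c _.
    by rewrite -!(scalerAl, scalerAr) !mulrA.
  rewrite yz [be == al]eq_sym; case: (al < ga)%N; case: (al == be);
    rewrite ?mulr0 ?mulr1 ?mul1r ?mul0r ?scale0r ?scaler0 //.
exact: H.
Qed.

End InverseMatrix.

(* With [S a] the sum of the [v c] over [c < a], the hypothesis says that
   [q ^- 2 ^+ (m - a) *: rho a] is [q] times the increment of
   [q ^- 2 ^+ (m - a + 1) *: S a], so the sum on the right telescopes. *)
Lemma triangular_inversion (q : CC) (m : nat) (V : lmodType CC) (v rho : 'I_m.+1 -> V) :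
  q != 0 ->
  (forall a : 'I_m.+1, q *: v a + (q - q^-1) *: \sum_(c < m.+1 | (c < a)%N) v c = rho a) ->
  forall a : 'I_m.+1,
  (q ^- 2) ^+ (m - a) *: v a =
  q *: ((q ^- 2) ^+ (m - a) *: rho a)
  + (q - q^-1) *: \sum_(c < m.+1 | (a < c)%N) (q ^- 2) ^+ (m - c) *: rho c
  + (1 - q ^+ 2) *: \sum_c v c.
Proof.
move=> qn0 H a; pose S (x : nat) := \sum_(c < m.+1 | (c < x)%N) v c.
have SS (x : 'I_m.+1) : S x.+1 = S x + v x.
  rewrite /S (bigD1 x) //= addrC; congr (_ + _); apply: eq_bigl => c.
  by rewrite -(inj_eq val_inj) /=; lia.
have rhoE (x : 'I_m.+1) : rho x = q *: S x.+1 - q^-1 *: S x.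
  by rewrite SS -H -/(S x) scalerDr scalerBl addrCA addrA.
(* The predecessor gives [g x.+1] the weight of [rho x], and [g m.+1] the weight 1. *)
pose g (x : nat) := (q ^- 2) ^+ (m - x.-1) *: S x.
have gE (x : 'I_m.+1) : (a < x)%N -> (q ^- 2) ^+ (m - x) *: rho x = q *: (g x.+1 - g x).
  move=> ax; rewrite rhoE /g /= !scalerBr !scalerA; congr (_ *: _ - _ *: _);
    first by rewrite mulrC.
  have -> : (m - x.-1 = (m - x).+1)%N by have := ltn_ord x; lia.
  by rewrite (exprS (q ^- 2)); move: (_ ^+ (m - x)) => e; field.
have -> : \sum_(c < m.+1 | (a < c)%N) (q ^- 2) ^+ (m - c) *: rho c = q *: (g m.+1 - g a.+1).
  rewrite (eq_bigr (fun c : 'I_m.+1 => q *: (g c.+1 - g c))) // -scaler_sumr; congr (_ *: _).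
  by rewrite -(telescope_sumr _ (ltn_ord a)) big_geq_mkord.
have -> : \sum_c v c = g m.+1.
  by rewrite /g /= subnn scale1r /S; apply: eq_bigl => c; rewrite ltn_ord.
rewrite /g /= subnn scale1r rhoE -[v a](addKr (S a)) -SS addrC.
move: (_ ^+ (m - a)) (S a) (S a.+1) (S m.+1) => e S0 S1 S2.
rewrite !(scalerDr, scalerN) !scalerA -!(@scaleNr _ V) (AC (2*2*1) ((1*4)*2*(3*5))) /=.
rewrite -!scalerDl; have -> : (q - q^-1) * q + (1 - q ^+ 2) = 0 by field.
by rewrite scale0r addr0; congr (_ *: _ + _ *: _); field.
Qed.

(** * The star relations for a rescaled inverse matrix *)

(** A pair of distinct indices is only rescaled, while [(a, a)] spreads over the pairs [(x, x)] with
    [a <= x]: hence the triangular system. *)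
Lemma sum_Rmat (q : CC) (n : nat) (V : lmodType CC) (F : 'I_n -> 'I_n -> V) (a b : 'I_n) :
  \sum_(x < n) \sum_(y < n) Rmat q b a y x *: F x y =
  if a == b then F a a + (1 - q ^- 2) *: \sum_(x < n | (a < x)%N) F x x
  else q^-1 *: F a b.
Proof.
rewrite /Rmat; have [<-|ab] := eqVneq a b.
  rewrite /= scaler_sumr [in RHS]big_mkcond /=.
  rewrite -[F a a](sum_delta (fun x => F x x) a) -big_split /=.
  apply: eq_bigr => x _; rewrite -(sum_delta (fun y => F x y *+ (x == a)) x).
  rewrite -[in RHS](sum_delta
    (fun y => if (a < x)%N then (1 - q ^- 2) *: F x y else 0) x) -big_split /=.
  apply: eq_bigr => y _; have [->|yx] := eqVneq y x;
    last by rewrite andbF /= scale0r !mulr0n addr0.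
  rewrite andbT !mulr1n eq_sym; have [->|xa] := eqVneq x a;
    first by rewrite ltnn scale1r addr0.
  by rewrite opprB mulr0n add0r /=; case: (a < x)%N; rewrite ?scale0r.
rewrite -(sum_delta (fun x => q^-1 *: F x b) a); apply: eq_bigr => x _.
rewrite -(sum_delta (fun y => (q^-1 *: F x y) *+ (x == a)) b); apply: eq_bigr => y _.
rewrite /= [b == y]eq_sym [a == x]eq_sym.
by case: (y == b); case: (x == a); rewrite /= ?scale0r ?mulr0n ?mul0rn.
Qed.

Section StarRelations.

Context (q : CC) (m : nat) (A : algType CC) (z y w : 'I_m.+1 -> 'I_m.+1 -> A).
Hypothesis qn0 : q != 0.
Hypothesis zR : relR q z.
Hypothesis yz : forall be al, \sum_c y be c * z c al = (be == al)%:R.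
Hypothesis zy : forall a b, \sum_ga z a ga * y ga b = (a == b)%:R.
Hypothesis wE : forall b be : 'I_m.+1, w b be = (q ^- 2) ^+ (m - b) *: y be b.

(** The sum over upper indices produces the right side [r] of [inverse_RTT]. The sum over lower
    indices then recovers the left side, directly for [a != b] and by [triangular_inversion] for
    [a = b]. *)
Lemma inverse_star_relations (a b al be : 'I_m.+1) :
  w b be * z a al =
  q ^+ 2 *: (\sum_(a' < m.+1) \sum_(b' < m.+1) \sum_(al' < m.+1) \sum_(be' < m.+1)
     (Rmat q b a b' a' * Rmat q be al be' al') *: (z a' al' * w b' be'))
  + ((1 - q ^+ 2) * ((a == b)%:R * (al == be)%:R)) *: 1.
Proof.
pose r x x' := q ^+ (al == be) *: (z x al * y be x')
  + ((q - q^-1) * (al == be)%:R) *: \sum_(ga < m.+1 | (al < ga)%N) z x ga * y ga x'.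
(* The weight of [w x' be'] depends only on [x'], so it leaves the sum over upper indices. *)
have rE x x' :
    \sum_(al' < m.+1) \sum_(be' < m.+1) Rmat q be al be' al' *: (z x al' * w x' be') =
   q^-1 *: ((q ^- 2) ^+ (m - x') *: r x x').
  rewrite (sum_Rmat q (fun al' be' => z x al' * w x' be')) /r.
  have [<-|ne] := eqVneq al be; last by rewrite mulr0 scale0r addr0 scale1r wE -scalerAr.
  rewrite mulr1 wE -scalerAr; under eq_bigr => ga _ do rewrite wE -scalerAr.
  rewrite -scaler_sumr !scalerDr !scalerA; move: (_ ^+ (m - x')) => e.
  by congr (_ *: _ + _ *: _); field.
under eq_bigr => a' _ do under eq_bigr => b' _ do
  (under eq_bigr => al' _ do (under eq_bigr => be' _ do rewrite -scalerA;
    rewrite -scaler_sumr);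
   rewrite -scaler_sumr rE).
rewrite (sum_Rmat q (fun a' b' => q^-1 *: ((q ^- 2) ^+ (m - b') *: r a' b'))).
have [<-|ne] := eqVneq a b; last first.
  rewrite mul0r mulr0 scale0r addr0.
  have := inverse_RTT qn0 zR yz zy a b al be;
    rewrite (negbTE ne) mulr0 scale0r addr0 scale1r -/(r a b) => <-.
  rewrite wE -scalerAl !scalerA; congr (_ *: _); move: (_ ^+ (m - b)) => e; by field.
rewrite mul1r wE -scalerAl.
(* The diagonal relations form a triangular system in the products [y be c * z c al], whose total is
   a Kronecker delta: this is the constant term. *)
have H (x : 'I_m.+1) :
    q *: (y be x * z x al) + (q - q^-1) *: \sum_(c < m.+1 | (c < x)%N) y be c * z c al
      = r x x.
  by rewrite -[RHS](inverse_RTT qn0 zR yz zy x x al be) eqxx mulr1.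
clearbody r; rewrite (triangular_inversion qn0 H a) yz [be == al]eq_sym.
rewrite -scaler_sumr scalerDr !scalerA.
congr (_ *: _ + _ *: _ + _).
- by move: (_ ^+ (m - a)) => e; field.
- by field.
- by case: (al == be); rewrite ?mulr1 ?mulr0 ?scaler0 ?scale0r.
Qed.

End StarRelations.

(** * The quantum adjugate and centrality of the determinant *)

Section Cofactors.

Context (q : CC) (m : nat) (A : algType CC) (z : 'I_m.+1 -> 'I_m.+1 -> A).
Hypothesis q0 : 0 < q.
Hypothesis zR : relR q z.

Let qn0 : q != 0. Proof. by rewrite gt_eqF. Qed.
Let nqn0 : - q != 0. Proof. by rewrite oppr_eq0. Qed.

(** The quantum adjugate, that is, the inverse matrix before division by the determinant; the
    exponent may be negative. *)
Definition qadj (be b : 'I_m.+1) : A := (- q) ^ (be%:Z - b%:Z) *: qcof q z b be.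

Lemma mul_mx_qadj (a b : 'I_m.+1) : \sum_ga z a ga * qadj ga b = qdet q z *+ (a == b).
Proof.
transitivity ((- q) ^ (- b%:Z) *: \sum_(al < m.+1) (- q) ^+ al *: (z a al * qcof q z b al)).
  rewrite scaler_sumr; apply: eq_bigr => ga _.
  by rewrite /qadj -scalerAr expfzDr // mulrC -scalerA.
rewrite (laplace_first qn0 zR) scalerA mulrA exprnP -expfzDr // addrC.
by have [->|_] := eqVneq a b; rewrite ?mulr0 ?scale0r // subrr mulr1 scale1r.
Qed.

(** Transposition turns the expansion along the last row into a column expansion with the generator
    on the right. *)
Lemma mul_qadj_mx (be al : 'I_m.+1) : \sum_c qadj be c * z c al = qdet q z *+ (be == al).
Proof.
have T := relR_transposed zR.
have cofT b c : qcof q (transposed z) b c = qcof q z c b.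
  by apply: qminor_transposed => // x x'; rewrite lift_ltn.
have detT : qdet q (transposed z) = qdet q z by apply: qminor_transposed.
transitivity ((- q) ^ (be%:Z - m%:Z) *: \sum_(c < m.+1)
    (- q) ^+ (m - c) *: (qcof q (transposed z) be c * transposed z al c)).
  rewrite scaler_sumr; apply: eq_bigr => c _.
  rewrite cofT /qadj -scalerAl scalerA exprnP -expfzDr //; congr (_ ^ _ *: _).
  by have := ltn_ord c; lia.
rewrite (laplace_last qn0 T) detT scalerA mulrA exprnP -expfzDr // eq_sym.
have [->|_] := eqVneq be al; rewrite ?mulr0 ?scale0r // mulr1.
have -> : al%:Z - m%:Z + (m - al)%N%:Z = 0 by have := ltn_ord al; lia.
by rewrite scale1r.
Qed.

(** The product of [z], [qadj] and [z] is associated in two ways. *)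
Lemma qdet_central (a al : 'I_m.+1) : qdet q z * z a al = z a al * qdet q z.
Proof.
transitivity (\sum_ga \sum_c z a ga * qadj ga c * z c al).
  rewrite exchange_big /= -(sum_delta (fun c => qdet q z * z c al) a).
  by apply: eq_bigr => c _; rewrite -mulr_suml mul_mx_qadj eq_sym mulrnAl.
rewrite -(sum_delta (fun ga => z a ga * qdet q z) al).
apply: eq_bigr => ga _; rewrite -mulrnAr -mul_qadj_mx mulr_sumr.
by apply: eq_bigr => c _; rewrite mulrA.
Qed.

End Cofactors.

(** * Transfer to the involution, and the homomorphism *)

Lemma relStar_PolSU (q : CC) (n : nat) (A : algType CC) (st : A -> A) (z : 'I_n -> 'I_n -> A) :
  0 < q -> is_PolSU q st z -> relStar q z st.
Proof.
case: n z => [|m] z q0 [[zR _ _] _ [u [uD Du stE]]] a b al be; first by case: a.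
have qn0 : q != 0 by rewrite gt_eqF.
(* The inverse of the central determinant commutes with the generators, which makes [u * qadj] a
   right inverse too. *)
have uz x x' : u * z x x' = z x x' * u.
  by rewrite -[LHS]mulr1 -Du mulrA -[u * _ * _]mulrA -(qdet_central q0 zR) mulrA uD mul1r.
apply: (@inverse_star_relations q m A z (fun be b => u * qadj q z be b)
  (fun b be => st (z b be))) => //.
- move=> b' al'; under eq_bigr => c _ do rewrite -mulrA.
  by rewrite -mulr_sumr mul_qadj_mx // mulrnAr uD.
- move=> a' b'; under eq_bigr => c _ do rewrite mulrA -uz -mulrA.
  by rewrite -mulr_sumr mul_mx_qadj // mulrnAr uD.
- move=> b' be'; rewrite stE /qadj -scalerAr scalerA; congr (_ *: _).
  (* The exponent of the involution is [(be' - b') + 2 (b' - m)]; the sign disappears from the even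
     part. *)
  have -> : (q ^- 2) ^+ (m - b') = (- q) ^ (b'%:Z *+ 2 - m%:Z *+ 2).
    have -> : b'%:Z *+ 2 - m%:Z *+ 2 = - ((2 * (m - b'))%N%:Z) by have := ltn_ord b'; lia.
    by rewrite -exprnN exprM sqrrN exprVn.
  by rewrite -expfzDr ?oppr_eq0 //; congr (_ ^ _); lia.
Qed.

Theorem theorem1 (q : R) (n : nat) (hq : 0 < q < 1) (hn : (1 <= n)%N)
  (P : algType CC) (stP : P -> P) (zP : 'I_n -> 'I_n -> P)
  (G : algType CC) (stG : G -> G) (zG : 'I_n -> 'I_n -> G) :
  is_PolMat (q%:C)%C stP zP -> is_PolSU (q%:C)%C stG zG ->
  exists psi : P -> G,
    [/\ is_star_hom stP stG psi, (forall a al, psi (zP a al) = zG a al) &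
        forall phi : P -> G, is_star_hom stP stG phi ->
          (forall a al, phi (zP a al) = zG a al) -> forall x, phi x = psi x].
Proof.
case=> _ _ _ universal hG; have [[zR _ _] stG_inv _] := hG.
apply: universal => //; apply: relStar_PolSU hG.
by rewrite ltcR; case/andP: hq.
Qed.
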